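(* Let $\mu:\mathbb{C}\langle Z,Z^*\rangle\to\mathbb{C}$ be a linear functional with $\mu(1)=1$ (i.e. $\mu\in\mathcal{D}_{\mathrm{alg}}(1,* )$). The following statements (a) and (b) are equivalent. (a) $\mu$ is $\eta$-diagonal. (b) $\mu$ satisfies the following two conditions: ($\eta$DM1) whenever $w\in\mathcal{W}^+$ is not mixed-alternating, one has $\mu(Z^w)=0$; ($\eta$DM2) whenever $w\in\mathcal{W}^+$ is mixed-alternating with canonical factorization $w=w_1w_2\cdots w_p$, one has $\mu(Z^w)=\mu(Z^{w_1})\mu(Z^{w_2})\cdots\mu(Z^{w_p})$.
   Context: $\mathcal{W}^+=\bigsqcup_{n\ge1}\{1,*\}^n$ is the set of non-empty words over the two-letter alphabet $\{1,*\}$, a semigroup under concatenation; powers of words are with respect to concatenation. $\mathbb{C}\langle Z,Z^*\rangle$ is the algebra of complex polynomials in two non-commuting variables $Z,Z^*$; for $w=(\ell_1,\dots,\ell_n)\in\mathcal{W}^+$ put $Z^w=Z^{\ell_1}\cdots Z^{\ell_n}$ (with $Z^1=Z$), and similarly $z^w=z^{\ell_1}\cdots z^{\ell_n}$ for non-commuting formal indeterminates $z,z^*$. $\mathcal{D}_{\mathrm{alg}}(1,* )$ is the set of linear functionals $\mu$ on $\mathbb{C}\langle Z,Z^*\rangle$ with $\mu(1)=1$. The moment series of $\mu$ is $M_\mu=\sum_{w\in\mathcal{W}^+}\mu(Z^w)z^w\in\mathbb{C}\langle\langle z,z^*\rangle\rangle$ (formal power series in non-commuting $z,z^*$) and its $\eta$-series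 is $\eta_\mu=M_\mu(1+M_\mu)^{-1}$. A word is alternating if it equals $(1,* )^m$ (type $(1,* )$) or $( *,1)^m$ (type $( *,1)$) for some integer $m\ge1$. $\mu$ is $\eta$-diagonal if the coefficient of $z^w$ in $\eta_\mu$ is $0$ for every $w\in\mathcal{W}^+$ that is not alternating. A word $w=(\ell_1,\dots,\ell_n)\in\mathcal{W}^+$ is mixed-alternating if $n=2m$ is even and $\ell_{2k-1}\neq\ell_{2k}$ for $k=1,\dots,m$. Every mixed-alternating word can be written uniquely as a concatenation $w=w_1w_2\cdots w_p$, $p\ge1$, where each $w_i$ is alternating and $w_i$ is not of the same type as $w_{i+1}$ for $1\le i\le p-1$; this is its canonical factorization. *)

(* Defs.v *)
From HB Require Import structures.
From mathcomp Require Import all_boot all_order all_algebra.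
From mathcomp Require Import boolp functions reals complex monalg.

Set Implicit Arguments.
Unset Strict Implicit.
Unset Printing Implicit Defensive.

Import GRing.Theory.

Local Open Scope ring_scope.

(* Formal power series over a field K in non-commuting indeterminates indexed  *)
(* by I: f w is the coefficient of the monomial w, and the empty word is the   *)
(* monomial 1. Addition is pointwise and multiplication is the Cauchy product. *)
Definition ncseries (K : fieldType) (I : Type) : Type := seq I -> K.

HB.instance Definition _ (K : fieldType) (I : Type) :=
  GRing.Zmodule.copy (ncseries K I) (seq I -> K).

Section NCSeriesRing.

Variables (K : fieldType) (I : Type).
Implicit Types (f g h : ncseries K I) (w : seq I).

Definition ncs_one : ncseries K I := fun w => (nilp w)%:R.

Definition ncs_mul f g : ncseries K I :=
  fun w => \sum_(k < (size w).+1) f (take k w) * g (drop k w).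

Lemma ncs_addE f g w : (f + g) w = f w + g w.
Proof. by []. Qed.

Lemma ncs_oppE f w : (- f) w = - f w.
Proof. by []. Qed.

Lemma ncs_mul_nil f g : ncs_mul f g [::] = f [::] * g [::].
Proof. by rewrite /ncs_mul big_ord1. Qed.

Lemma ncs_mul_cons f g a w :
  ncs_mul f g (a :: w) =
    f [::] * g (a :: w) + ncs_mul (fun v => f (a :: v)) g w.
Proof. by rewrite /ncs_mul /= big_ord_recl. Qed.

Lemma ncs_mulDl : left_distributive ncs_mul +%R.
Proof.
move=> f g h; apply/funext => w; rewrite ncs_addE /ncs_mul -big_split /=.
by apply: eq_bigr => k _; rewrite ncs_addE mulrDl.
Qed.

Lemma ncs_mulDr : right_distributive ncs_mul +%R.
Proof.
move=> f g h; apply/funext => w; rewrite ncs_addE /ncs_mul -big_split /=.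
by apply: eq_bigr => k _; rewrite ncs_addE mulrDr.
Qed.

Lemma ncs_mulZl c f g w : ncs_mul (fun v => c * f v) g w = c * ncs_mul f g w.
Proof. by rewrite /ncs_mul mulr_sumr; apply: eq_bigr => k _; rewrite mulrA. Qed.

Lemma ncs_mulA : associative ncs_mul.
Proof.
move=> f g h; apply/funext => w; elim: w f => [|a w IHw] f.
  by rewrite !ncs_mul_nil mulrA.
rewrite !ncs_mul_cons IHw ncs_mul_nil mulrDr mulrA -addrA; congr (_ + _).
have -> : (fun v => ncs_mul f g (a :: v)) =
    (fun v => f [::] * g (a :: v) : K) + ncs_mul (fun v => f (a :: v)) g
    :> ncseries K I.
  by apply/funext => v; rewrite ncs_mul_cons.
by rewrite ncs_mulDl ncs_addE ncs_mulZl.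
Qed.

Lemma ncs_mul1 : left_id ncs_one ncs_mul.
Proof.
move=> f; apply/funext => -[|a w]; first by rewrite ncs_mul_nil mul1r.
rewrite ncs_mul_cons mul1r /ncs_mul big1 ?addr0 // => k _.
by rewrite /ncs_one mul0r.
Qed.

Lemma ncs_1mul : right_id ncs_one ncs_mul.
Proof.
move=> f; apply/funext => w; elim: w f => [|a w IHw] f.
  by rewrite ncs_mul_nil mulr1.
by rewrite ncs_mul_cons IHw mulr0 add0r.
Qed.

Lemma ncs_one_neq0 : ncs_one != 0.
Proof.
apply/eqP => /(congr1 (fun f : ncseries K I => f [::])) /eqP.
by rewrite oner_eq0.
Qed.

HB.instance Definition _ := GRing.Zmodule_isNzRing.Build (ncseries K I)
  ncs_mulA ncs_mul1 ncs_1mul ncs_mulDl ncs_mulDr ncs_one_neq0.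

Lemma ncs_mulE f g w :
  (f * g) w = \sum_(k < (size w).+1) f (take k w) * g (drop k w).
Proof. by []. Qed.

Lemma ncs_oneE w : (1 : ncseries K I) w = (nilp w)%:R.
Proof. by []. Qed.

Lemma ncs_sumE n (F : 'I_n -> ncseries K I) w :
  (\sum_(k < n) F k) w = \sum_(k < n) F k w.
Proof. by apply: (big_morph (fun f : ncseries K I => f w)). Qed.

Definition ncs_unit : pred (ncseries K I) := fun f => f [::] != 0.

(* Writing f = c (1 - h) with c the constant term of f, so that h has no       *)
(* constant term, the inverse is c^-1 times the geometric series of h, whose   *)
(* coefficient at w only involves the powers h^n with n <= size w.             *)
Definition ncs_geom h : ncseries K I :=
  fun w => (\sum_(n < (size w).+1) h ^+ n) w.

Definition ncs_inv f : ncseries K I :=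
  if f [::] == 0 then f
  else fun w =>
    (f [::])^-1 * ncs_geom (1 - ((fun v => (f [::])^-1 * f v) : ncseries K I)) w.

Lemma ncs_exp_small h n w : h [::] = 0 -> (size w < n)%N -> (h ^+ n) w = 0.
Proof.
move=> h0; elim: n w => // n IHn w; rewrite ltnS exprS ncs_mulE => lew.
rewrite big1 // => -[[|k] /= ltk] _; first by rewrite take0 h0 mul0r.
rewrite IHn ?mulr0 // size_drop; case: w lew ltk => // a w lew _.
by rewrite /= subSS (leq_ltn_trans (leq_subr _ _)).
Qed.

Lemma ncs_geom_trunc h N w : h [::] = 0 -> (size w <= N)%N ->
  ncs_geom h w = (\sum_(n < N.+1) h ^+ n) w.
Proof.
move=> h0 lewN; rewrite /ncs_geom !ncs_sumE.
rewrite (big_ord_widen N.+1 (fun n => (h ^+ n) w)) ?ltnS // big_mkcond /=.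
apply: eq_bigr => n _; case: ltnP => // lt_wn.
by rewrite ncs_exp_small.
Qed.

Lemma ncs_mul_eqr f g g' w :
  (forall v, (size v <= size w)%N -> g v = g' v) -> (f * g) w = (f * g') w.
Proof.
move=> eq_g; rewrite !ncs_mulE; apply: eq_bigr => k _.
by rewrite eq_g // size_drop leq_subr.
Qed.

Lemma ncs_mul_eql f f' g w :
  (forall v, (size v <= size w)%N -> f v = f' v) -> (f * g) w = (f' * g) w.
Proof.
move=> eq_f; rewrite !ncs_mulE; apply: eq_bigr => k _.
by rewrite eq_f // size_take; case: ltnP => // /ltnW.
Qed.

Lemma ncs_mul_geom h : h [::] = 0 -> (1 - h) * ncs_geom h = 1.
Proof.
move=> h0; apply/funext => w.
rewrite (@ncs_mul_eqr _ _ (\sum_(n < (size w).+1) h ^+ n) _); last first.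
  by move=> v; apply: ncs_geom_trunc.
have -> : (1 - h) * (\sum_(n < (size w).+1) h ^+ n) = 1 - h ^+ (size w).+1.
  by rewrite -[1 - h]opprB mulNr -subrX1 opprB.
by rewrite ncs_addE ncs_oppE ncs_exp_small // subr0.
Qed.

Lemma ncs_geom_mul h : h [::] = 0 -> ncs_geom h * (1 - h) = 1.
Proof.
move=> h0; apply/funext => w.
rewrite (@ncs_mul_eql _ (\sum_(n < (size w).+1) h ^+ n) _ _); last first.
  by move=> v; apply: ncs_geom_trunc.
have -> : (\sum_(n < (size w).+1) h ^+ n) * (1 - h) =
          (1 - h) * (\sum_(n < (size w).+1) h ^+ n).
  rewrite mulrBr mulrBl mulr1 mul1r; congr (_ - _).
  rewrite mulr_suml mulr_sumr; apply: eq_bigr => n _.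
  by rewrite -exprSr -exprS.
rewrite (@ncs_mul_eqr _ _ (ncs_geom h)) ?ncs_mul_geom // => v lev.
by rewrite (ncs_geom_trunc h0 lev).
Qed.

Lemma ncs_unit_decomp f : ncs_unit f ->
  exists h, [/\ h [::] = 0, forall w, f w = f [::] * (1 - h) w &
    forall w, ncs_inv f w = (f [::])^-1 * ncs_geom h w].
Proof.
move=> f0; exists (1 - ((fun v => (f [::])^-1 * f v) : ncseries K I)); split.
- by rewrite ncs_addE ncs_oppE mulVf ?subrr.
- by move=> w; rewrite subKr mulrA mulfV ?mul1r.
- by move=> w; rewrite /ncs_inv (negPf f0).
Qed.

Lemma ncs_scale_mul f f' g g' c d : c * d = 1 ->
  (forall w, f w = c * f' w) -> (forall w, g w = d * g' w) -> f * g = f' * g'.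
Proof.
move=> cd1 fE gE; apply/funext => w; rewrite !ncs_mulE; apply: eq_bigr => k _.
by rewrite fE gE mulrACA cd1 mul1r.
Qed.

Lemma ncs_mulVr : {in ncs_unit, left_inverse 1 ncs_inv *%R}.
Proof.
move=> f f0; have [h [h0 fE VE]] := ncs_unit_decomp f0.
by rewrite (ncs_scale_mul (mulVf f0) VE fE) ncs_geom_mul.
Qed.

Lemma ncs_divrr : {in ncs_unit, right_inverse 1 ncs_inv *%R}.
Proof.
move=> f f0; have [h [h0 fE VE]] := ncs_unit_decomp f0.
by rewrite (ncs_scale_mul (mulfV f0) fE VE) ncs_mul_geom.
Qed.

Lemma ncs_unitrP f g : g * f = 1 /\ f * g = 1 -> ncs_unit f.
Proof.
case=> _ /(congr1 (fun u : ncseries K I => u [::])).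
rewrite [LHS]ncs_mul_nil ncs_oneE => fg1; apply/eqP => f0.
by move: fg1; rewrite f0 mul0r => /eqP; rewrite eq_sym oner_eq0.
Qed.

Lemma ncs_invr_out : {in [predC ncs_unit], ncs_inv =1 id}.
Proof. by move=> f; rewrite inE negbK /ncs_inv => ->. Qed.

HB.instance Definition _ := GRing.NzRing_hasMulInverse.Build (ncseries K I)
  ncs_mulVr ncs_divrr ncs_unitrP ncs_invr_out.

End NCSeriesRing.

(* The two-letter alphabet {1, *}; the letter other than l is ~~ l. *)
Notation letter := bool.
Definition letter_one : letter := false.
Definition letter_star : letter := true.

(* Words may be empty here; membership in W^+ is the condition w <> [::]. *)
Notation word := (seq letter).

(* (l, ~~ l)^m *)
Definition alt_word (l : letter) (m : nat) : word :=
  flatten (nseq m [:: l; ~~ l]).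

(* The type of an alternating word is recorded by its first letter. *)
Definition alternating_of_type (l : letter) (w : word) : Prop :=
  exists m : nat, (1 <= m)%N /\ w = alt_word l m.

Definition alternating (w : word) : Prop :=
  alternating_of_type letter_one w \/ alternating_of_type letter_star w.

Definition same_type (u v : word) : Prop :=
  exists l : letter, alternating_of_type l u /\ alternating_of_type l v.

(* Letters are numbered from 0, so the letters l_(2k-1) and l_(2k), 1 <= k <= m, *)
(* are those at positions 2k and 2k+1 for 0 <= k < m.                           *)
Definition mixed_alternating (w : word) : Prop :=
  w <> [::] /\
  exists m : nat, size w = m.*2 /\
    forall k : nat, (k < m)%N ->
      nth letter_one w k.*2 <> nth letter_one w k.*2.+1.

Definition canonical_factorization (w : word) (ws : seq word) : Prop :=
  [/\ (1 <= size ws)%N,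
      w = flatten ws,
      forall i : nat, (i < size ws)%N -> alternating (nth [::] ws i) &
      forall i : nat, (i.+1 < size ws)%N ->
        ~ same_type (nth [::] ws i) (nth [::] ws i.+1)].

(* The algebra C<Z, Z^*>, as the monoid algebra of the free monoid on letters. *)
Notation ncpoly R := {malg R[i][{fmonom letter}]}.

Section EtaSeries.

Variable R : realType.

Definition Zletter (l : letter) : ncpoly R := mkmalgU (fmu l) 1.

Definition Zword (w : word) : ncpoly R := \prod_(l <- w) Zletter l.

Definition moment_series (mu : {scalar ncpoly R}) : ncseries R[i] letter :=
  fun w => if nilp w then 0 else mu (Zword w).

Lemma moment_series_unit (mu : {scalar ncpoly R}) :
  1 + moment_series mu \is a GRing.unit.
Proof. by rewrite unfold_in /= /ncs_unit ncs_addE /= addr0 oner_neq0. Qed.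

Definition eta_series (mu : {scalar ncpoly R}) : ncseries R[i] letter :=
  moment_series mu * (1 + moment_series mu)^-1.

Definition eta_diagonal (mu : {scalar ncpoly R}) : Prop :=
  forall w : word, w <> [::] -> ~ alternating w -> eta_series mu w = 0.

Definition eta_DM1 (mu : {scalar ncpoly R}) : Prop :=
  forall w : word, w <> [::] -> ~ mixed_alternating w -> mu (Zword w) = 0.

Definition eta_DM2 (mu : {scalar ncpoly R}) : Prop :=
  forall (w : word) (ws : seq word),
    mixed_alternating w -> canonical_factorization w ws ->
    mu (Zword w) = \prod_(v <- ws) mu (Zword v).

End EtaSeries.

(* Main.v *)
Require Import Defs.
From mathcomp Require Import all_boot all_order all_algebra.
From mathcomp Require Import reals complex monalg.

(* Write g = 1 + M and e = eta, so that (1 - e) g = g (1 - e) = 1. Since the   *)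
(* words [pair_word s] form a submonoid, e is supported on them iff g is. On   *)
(* that submonoid, alternating words are the constant sequences s, and the     *)
(* canonical factorization is the decomposition of s into maximal runs.        *)
(* Expanding g = 1 + e g at u v, with u a maximal initial run, the prefixes    *)
(* inside u contribute (e g)(u) g(v) = g(u) g(v) once g is multiplicative on   *)
(* runs, and the longer ones only involve e at non-constant sequences.         *)

Set Implicit Arguments.
Unset Strict Implicit.

Import GRing.Theory.

Local Open Scope ring_scope.

(** With $g=1+M_\mu$ one has $1-\eta_\mu=g^{-1}$. Supports in a submonoid pass to inverses
    ([ncs_mulV_support]), so ($\eta$DM1) says that $\eta_\mu$ lives on the words [pair_word s].
    There the Cauchy product becomes the one in the sequence [s] ([on_pairs_mul]), and what remains
    is [supported_on_runsP]: vanishing of $\eta_\mu$ at non-constant sequences is equivalent to $g$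
    factoring over maximal runs, that is, to ($\eta$DM2). *)

(** * Supports and runs for series over an arbitrary alphabet *)

Section Series.

Variables (K : fieldType) (I : eqType).
Implicit Types (e f g h : ncseries K I) (u v w s : seq I).

(** In $(fh)(w)=0$ isolate the term $h(w)$. Every other term vanishes: if its prefix lies in [S],
    the shorter suffix does not, and induction applies. *)
Lemma ncs_mulV_support (S : seq I -> Prop) f h w :
    S [::] -> (forall u v, S u -> S v -> S (u ++ v)) ->
    f [::] = 1 -> f * h = 1 -> (forall v, ~ S v -> f v = 0) ->
  ~ S w -> h w = 0.
Proof.
move=> S0 Scat f0 fh1 fS.
have [n] := ubnP (size w); elim: n w => // n IHn [|a w] //; rewrite ltnS => lewn nSw.
have /(congr1 (fun x : ncseries K I => x (a :: w))) := fh1.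
rewrite ncs_mulE ncs_oneE big_ord_recl take0 drop0 f0 mul1r big1 ?addr0 // => k _.
have [->|/eqP fk] := eqVneq (f (take (lift ord0 k) (a :: w))) 0; first by rewrite mul0r.
rewrite IHn ?mulr0 //; first by rewrite size_drop /= subSS (leq_trans _ lewn) // ltnS leq_subr.
move=> Sd; apply: fk; apply: fS => St; apply: nSw.
by rewrite -[_ :: w](cat_take_drop (lift ord0 k)); apply: Scat.
Qed.

Lemma ncs_mul_cat f g u v :
  (f * g) (u ++ v) = (f * ((fun x => g (x ++ v)) : ncseries K I)) u
    + \sum_(k < size v) f (u ++ take k.+1 v) * g (drop k.+1 v).
Proof.
elim: u f => [|a u IHu] f.
  by rewrite ncs_mulE big_ord_recl take0 drop0 [X in _ = X + _]ncs_mul_nil.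
have E (h : ncseries K I) w : (f * h) (a :: w) =
    f [::] * h (a :: w) + (((fun x => f (a :: x)) : ncseries K I) * h) w.
  exact: ncs_mul_cons.
by rewrite cat_cons !E IHu addrA.
Qed.

Lemma nseq_prefixP (l : I) s :
  (exists m, s = nseq m l) \/
  exists m, exists a, exists v, a != l /\ s = nseq m l ++ a :: v.
Proof.
elim: s => [|b s IHs]; first by left; exists 0.
have [->|bl] := eqVneq b l; last by right; exists 0, b, s.
case: IHs => [[m ->]|[m [a [v [al ->]]]]]; first by left; exists m.+1.
by right; exists m.+1, a, v.
Qed.

(** A non-constant sequence is exactly a nonempty run followed by a different letter. *)
Definition supported_on_runs e : Prop :=
  forall l m a v, a != l -> e (nseq m.+1 l ++ a :: v) = 0.

Definition multiplicative_on_runs g : Prop :=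
  forall l m a v, a != l ->
    g (nseq m l ++ a :: v) = g (nseq m l) * g (a :: v).

(** As $e$ kills the empty prefix, only remainders shorter than the run occur; this is what lets
    [supported_on_runsP] induct on run length. *)
Lemma ncs_mul_nseq_cat e g l m v : e [::] = 0 ->
    (forall j, (j < m)%N -> g (nseq j l ++ v) = g (nseq j l) * g v) ->
  (e * ((fun x => g (x ++ v)) : ncseries K I)) (nseq m l) =
    (e * g) (nseq m l) * g v.
Proof.
move=> e0 gM; rewrite !ncs_mulE mulr_suml; apply: eq_bigr => k _.
case: k => [[|k] ltk] /=; first by rewrite take0 e0 !mul0r.
move: ltk; rewrite size_nseq => ltk; rewrite drop_nseq gM ?mulrA //.
by case: m ltk {gM} => // m _; rewrite subSS ltnS leq_subr.
Qed.

Lemma supported_on_runsP e g :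
    e [::] = 0 -> g [::] = 1 -> (forall s, s <> [::] -> (e * g) s = g s) ->
  supported_on_runs e <-> multiplicative_on_runs g.
Proof.
move=> e0 g0 eg; split=> [eS l m a v al | gM l m a v al].
  have [n] := ubnP m; elim: n m => // n IHn [|m] ltmn; first by rewrite g0 mul1r.
  rewrite -eg // ncs_mul_cat ncs_mul_nseq_cat //; last first.
    by move=> j ltj; apply: IHn; apply: leq_trans ltj _.
  (* Cuts beyond the run evaluate $e$ at non-constant sequences. *)
  by rewrite eg // big1 ?addr0 // => k _; rewrite eS ?mul0r.
have [n] := ubnP (size v); elim: n v => // n IHn v; rewrite ltnS => levn.
have : (e * g) (nseq m.+1 l ++ a :: v) = g (nseq m.+1 l ++ a :: v) by rewrite eg.
rewrite ncs_mul_cat ncs_mul_nseq_cat //; last by move=> j _; apply: gM.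
(* Cuts inside the run already give the whole right-hand side, so the others sum to zero; by
   induction only the cut at the very end survives, with factor $g$ at the empty word. *)
rewrite eg // -gM // -[RHS]addr0 => /addrI.
rewrite big_ord_recr /= take_size drop_size g0 mulr1 big1 ?add0r // => k _.
have := IHn (take k v); rewrite /= => ->; rewrite ?mul0r //.
by rewrite size_take ltn_ord (leq_trans (ltn_ord k)).
Qed.

End Series.

(** * Mixed-alternating words as sequences of two-letter blocks *)

Definition pair_word (s : seq letter) : word :=
  flatten [seq [:: l; ~~ l] | l <- s].

Lemma pair_word_cat s t : pair_word (s ++ t) = pair_word s ++ pair_word t.
Proof. by rewrite /pair_word map_cat flatten_cat. Qed.

Lemma alt_wordE l m : alt_word l m = pair_word (nseq m l).
Proof. by rewrite /alt_word /pair_word map_nseq. Qed.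

Lemma pair_word_inj : injective pair_word.
Proof. by elim=> [|a s IHs] [|b t] //= [-> _ /IHs ->]. Qed.

Lemma pair_word_mixed s : s <> [::] -> mixed_alternating (pair_word s).
Proof.
move=> s0; split; first by case: s s0.
exists (size s); split; first by elim: s {s0} => //= a s ->.
elim: s {s0} => //= a s IHs [|k] /=; first by case: a.
by rewrite ltnS; apply: IHs.
Qed.

Lemma mixed_alternatingP w :
  mixed_alternating w <-> exists2 s, s <> [::] & w = pair_word s.
Proof.
split=> [[w0 [m [szw wE]]] | [s s0 ->]]; last exact: pair_word_mixed.
suff [s ws] : exists s, w = pair_word s by exists s => // s0; apply: w0; rewrite ws s0.
elim: m w {w0} szw wE => [|m IHm] [|a [|b w]] //=; first by exists [::].
move=> [szw] wE.
have [|s ->] := IHm w szw; first by move=> k; apply: (wE k.+1).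
exists (a :: s); rewrite /pair_word /=; congr [:: _, _ & _].
by have := wE 0 isT; rewrite /=; case: a b {wE} => [] [].
Qed.

Lemma alternatingP w :
  alternating w <-> exists l, exists m, w = pair_word (nseq m.+1 l).
Proof.
split.
  by case=> -[[|m] [] // _ ->]; rewrite alt_wordE;
    [exists letter_one, m | exists letter_star, m].
by move=> [[] [m ->]]; [right | left]; exists m.+1; rewrite alt_wordE.
Qed.

Lemma canonical_factorization_cons l m s ws :
    (forall t, s <> l :: t) -> canonical_factorization (pair_word s) ws ->
  canonical_factorization (pair_word (nseq m.+1 l ++ s))
    (pair_word (nseq m.+1 l) :: ws).
Proof.
move=> sl [ws0 sE wsA wsT]; split=> //; first by rewrite pair_word_cat sE.
  by move=> [|i] /=; [move=> _; apply/alternatingP; exists l, m | apply: wsA].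
move=> [|i] /=; last exact: wsT.
move=> _ [l' [[[|n] [] // _]]]; rewrite alt_wordE => /pair_word_inj [ll' _].
subst l'; case: ws ws0 sE {wsA wsT} => // w ws _ sE [[|k] [] // _ /= wE].
by move: sE; rewrite wE; case: s sl => // b s sl [bl]; case: (sl s); rewrite bl.
Qed.

(** Peel off the maximal initial run and recurse on the rest. *)
Lemma canonical_factorization_exists s : s <> [::] ->
  exists ws, canonical_factorization (pair_word s) ws.
Proof.
have [n] := ubnP (size s); elim: n s => // n IHn [|l s] // ltsn _.
have base m : exists ws, canonical_factorization (pair_word (nseq m.+1 l)) ws.
  exists [:: pair_word (nseq m.+1 l)]; split=> //; first by rewrite /= cats0.
  by move=> [|//] _; apply/alternatingP; exists l, m.
case: (nseq_prefixP l s) => [[m ->]|[m [a [v [al sE]]]]]; first exact: base.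
have [||ws wsP] := IHn (a :: v) => //.
  by move: ltsn; rewrite sE /= size_cat /= size_nseq !ltnS; apply: leq_trans; rewrite ltnS leq_addl.
exists (pair_word (nseq m.+1 l) :: ws).
have -> : l :: s = nseq m.+1 l ++ a :: v by rewrite sE.
by apply: canonical_factorization_cons => // t [/eqP]; rewrite (negPf al).
Qed.

(** * Restricting series to pair words *)

Section PairWordSeries.

Variable K : fieldType.
Implicit Types f g : ncseries K letter.

Definition on_pairs f : ncseries K letter := fun s => f (pair_word s).

Definition supported_on_pairs f : Prop :=
  forall w, ~ (exists s, w = pair_word s) -> f w = 0.

Lemma on_pairs_mul f g s : supported_on_pairs f ->
  on_pairs (f * g) s = (on_pairs f * on_pairs g) s.
Proof.
have E (h k : ncseries K letter) a w : (h * k) (a :: w) =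
    h [::] * k (a :: w) + (((fun x => h (a :: x)) : ncseries K letter) * k) w.
  exact: ncs_mul_cons.
elim: s f => [|a s IHs] f fS; first by rewrite /on_pairs ![LHS]ncs_mul_nil [RHS]ncs_mul_nil.
(* A cut in the middle of a block leaves a prefix of odd length, where $f$ vanishes. *)
rewrite [RHS]E /on_pairs -[pair_word (a :: s)]/[:: a, ~~ a & pair_word s] !E.
rewrite (fS [:: a]) ?mul0r ?add0r; last by case=> -[|b t].
congr (_ + _); apply: IHs => w nw.
apply: fS => -[[|b t] //] [_ _ wE]; by apply: nw; exists t.
Qed.

Lemma supported_on_pairs_mulV f g :
    f [::] = 1 -> f * g = 1 -> supported_on_pairs f -> supported_on_pairs g.
Proof.
move=> f0 fg1 fS w; apply: ncs_mulV_support fg1 fS => //; first by exists [::].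
by move=> u v [s ->] [t ->]; exists (s ++ t); rewrite pair_word_cat.
Qed.

Lemma multiplicative_flatten g ws : multiplicative_on_runs (on_pairs g) ->
    g [::] = 1 ->
    (forall i, (i < size ws)%N -> alternating (nth [::] ws i)) ->
    (forall i, (i.+1 < size ws)%N ->
       ~ same_type (nth [::] ws i) (nth [::] ws i.+1)) ->
  g (flatten ws) = \prod_(v <- ws) g v.
Proof.
move=> gM g0 wsA wsT.
(* The last clause ties the first letter of [s] to the type of the first factor, so that a type
   change between factors becomes a change of letter. *)
suff [s [_ -> _]] : exists s, [/\ flatten ws = pair_word s,
    g (flatten ws) = \prod_(v <- ws) g v &
    forall a t, s = a :: t -> (0 < size ws)%N /\ alternating_of_type a (head [::] ws)].
  by [].
elim: ws wsA wsT => [|w ws IHws] wsA wsT; first by exists [::]; rewrite big_nil.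
have [i lti|i lti|s [wsE gws sP]] := IHws; [exact: (wsA i.+1) | exact: (wsT i.+1) |].
have /alternatingP [l [m wE]] := wsA 0 isT; rewrite /= in wE.
have wl : alternating_of_type l w by exists m.+1; rewrite alt_wordE.
exists (nseq m.+1 l ++ s); split; last by move=> a t [<- _].
  by rewrite pair_word_cat -wE -wsE.
rewrite big_cons -gws -[flatten (w :: ws)]/(w ++ flatten ws) wE wsE -pair_word_cat.
case: s sP {wsE} => [|a t] sP; first by rewrite cats0 g0 mulr1.
apply: (gM l m.+1 a t); apply/eqP => al; have [ws0 tP] := sP a t erefl.
apply: (wsT 0); first by rewrite /= ltnS.
by exists l; split; rewrite //= nth0 -al.
Qed.

End PairWordSeries.

(** * Translating the conditions on $\mu$ into conditions on series *)

Section EtaDiagonal.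

Variables (R : realType) (mu : {scalar ncpoly R}).
Hypothesis mu1 : mu 1 = 1.

Let e := eta_series mu.
Let g := 1 + moment_series mu.

Lemma mu_Zword w : mu (Zword R w) = g w.
Proof.
rewrite /g ncs_addE ncs_oneE /moment_series.
by case: w => [|a w]; rewrite ?addr0 ?add0r // /Zword big_nil.
Qed.

Lemma one_sub_eta : 1 - e = g^-1.
Proof.
have gU : g \is a GRing.unit := moment_series_unit mu.
by rewrite -[LHS](mulrK gU) mulrBl mul1r /e /eta_series -/g divrK // /g addrK mul1r.
Qed.

Lemma moment_nil : g [::] = 1.
Proof. by rewrite -mu_Zword /Zword big_nil. Qed.

Lemma eta_nil : e [::] = 0.
Proof. by rewrite /e /eta_series [LHS]ncs_mul_nil mul0r. Qed.

Lemma eta_mul_moment w : w <> [::] -> (e * g) w = g w.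
Proof.
move=> w0; rewrite /e /eta_series divrK ?moment_series_unit //.
by rewrite /g ncs_addE ncs_oneE; case: w w0 => // a w _; rewrite add0r.
Qed.

Lemma eta_supported_on_pairs : supported_on_pairs e <-> supported_on_pairs g.
Proof.
have gU : g \is a GRing.unit := moment_series_unit mu.
(* The empty word is a pair word, so the constant 1 is invisible off pair words. *)
have E w : ~ (exists s, w = pair_word s) -> (1 - e) w = - e w.
  move=> nw; rewrite ncs_addE ncs_oppE ncs_oneE.
  by case: w nw => [[]|a w _]; [exists [::] | rewrite add0r].
split=> [eS | gS].
  apply: (@supported_on_pairs_mulV _ (1 - e)).
  - by rewrite ncs_addE ncs_oppE eta_nil subr0.
  - by rewrite one_sub_eta mulVr.
  - by move=> w nw; rewrite E // eS ?oppr0.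
move=> w nw; apply: oppr_inj; rewrite -E // oppr0.
apply: (@supported_on_pairs_mulV _ g) nw => //; first exact: moment_nil.
by rewrite one_sub_eta mulrV.
Qed.

Lemma eta_DM1P : eta_DM1 mu <-> supported_on_pairs g.
Proof.
split=> H w.
  move=> nw; rewrite -mu_Zword; apply: H; first by move=> w0; apply: nw; exists [::].
  by move=> /mixed_alternatingP [s _ wE]; apply: nw; exists s.
move=> w0 nw; rewrite mu_Zword; apply: H => -[s wE]; apply: nw.
by apply/mixed_alternatingP; exists s => // s0; apply: w0; rewrite wE s0.
Qed.

(** Forward, compare the products for a factorization of the tail and for the same one with the
    initial run prepended. *)
Lemma eta_DM2P : eta_DM2 mu <-> multiplicative_on_runs (on_pairs g).
Proof.
split=> [H l [|m] a v al | gM w ws _ [_ -> wsA wsT]].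
- by rewrite /on_pairs moment_nil mul1r.
- have [//|ws wsP] := @canonical_factorization_exists (a :: v).
  have wsP' : canonical_factorization (pair_word (nseq m.+1 l ++ a :: v))
      (pair_word (nseq m.+1 l) :: ws).
    by apply: canonical_factorization_cons => // t [/eqP]; rewrite (negPf al).
  rewrite /on_pairs -!mu_Zword (H _ _ _ wsP); last exact: pair_word_mixed.
  by rewrite (H _ _ _ wsP') ?big_cons //; apply: pair_word_mixed.
rewrite mu_Zword (multiplicative_flatten gM moment_nil) //.
by apply: eq_bigr => v _; rewrite mu_Zword.
Qed.

Lemma eta_diagonalP :
  eta_diagonal mu <->
  supported_on_pairs e /\ supported_on_runs (on_pairs e).
Proof.
split=> [H | [eS eR] w w0 nw].
  split=> [w nw | l m a v al].
    apply: H; first by move=> w0; apply: nw; exists [::].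
    by move=> /alternatingP [l [m wE]]; apply: nw; exists (nseq m.+1 l).
  apply: H => // /alternatingP [b [n /pair_word_inj E]].
  have c x : x \in nseq m.+1 l ++ a :: v -> x = b by rewrite E => /nseqP [].
  have ab : a = b by apply: c; rewrite mem_cat mem_head orbT.
  by case/eqP: al; rewrite ab (c l) // in_cons eqxx.
have [[s wE]|] := boolp.pselect (exists s, w = pair_word s); last exact: eS.
case: s wE => [|l s] wE; first by rewrite wE in w0.
case: (nseq_prefixP l s) => [[m sE]|[m [a [v [al sE]]]]].
  by case: nw; apply/alternatingP; exists l, m; rewrite wE sE.
by rewrite wE sE; apply: (eR l m a v).
Qed.

Lemma eta_diagonal_DM : eta_diagonal mu <-> eta_DM1 mu /\ eta_DM2 mu.
Proof.
have runs : supported_on_pairs e ->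
    supported_on_runs (on_pairs e) <-> multiplicative_on_runs (on_pairs g).
  move=> eS; apply: supported_on_runsP; first exact: eta_nil.
    exact: moment_nil.
  by move=> s s0; rewrite -on_pairs_mul //; apply: eta_mul_moment; case: s s0.
split=> [/eta_diagonalP [eS /(runs eS) gM] | [/eta_DM1P gS /eta_DM2P gM]].
  by split; [apply/eta_DM1P/eta_supported_on_pairs | apply/eta_DM2P].
have eS : supported_on_pairs e by apply/eta_supported_on_pairs.
by apply/eta_diagonalP; split=> //; apply/runs.
Qed.

End EtaDiagonal.

Theorem theorem2p8 (R : realType) (mu : {scalar ncpoly R}) (hmu1 : mu 1 = 1) :
  eta_diagonal mu <-> (eta_DM1 mu /\ eta_DM2 mu).
Proof. exact: eta_diagonal_DM. Qed.
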